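(* Every circuit game is immune to the informational Braess' paradox. That is, for every network congestion game (possibly with several origin–destination pairs) in which each population's relevant network is a single cycle, for all continuous non-decreasing non-negative edge costs, demands and information sets, and for every expansion $E_{11}\subset\tilde E_{11}$ of the information set of type $(1,1)$ with all other information sets unchanged, if $\bm{x}$ and $\tilde{\bm{x}}$ are ICUE before and after the expansion respectively, then $C_{11}(\tilde{\bm{x}})\le C_{11}(\bm{x})$.
   Context: A nonatomic network congestion game is played on an undirected network $G=(V,E)$ with edge cost functions $c_e:\mathbb{R}_{\ge 0}\to\mathbb{R}_{\ge 0}\cup\{\infty\}$ that are continuous, non-decreasing and non-negative. There is a finite set $N$ of populations; population $i$ travels from origin $O_i$ to destination $D_i$, distinct populations having distinct origin–destination pairs. The relevant edge set $E_i$ of population $i$ consists of the edges lying on at least one simple $O_i$–$D_i$ path, and $G_i=(V_i,E_i)$ is its relevant network. Population $i$ is divided into information types $k\in K_i$, each with demand $d_{ik}\ge 0$ and information set $E_{ik}\subseteq E_i$; the strategy set $S_{ik}$ of type $(i,k)$ consists of the simple $O_i$–$D_i$ paths using only edges of $E_{ik}$ (assumed nonempty). An outcome $\bm{x}$ assigns flows $x^{ik}_s\ge 0$ to $s\in S_{ik}$ with $\sum_{s\in S_{ik}}x^{ik}_s=d_{ik}$. The load of edge $e$ is $f_e(\bm{x})=\sum_{i,k}\sum_{s\in S_{ik},\,e\in s}x^{ik}_s$ and the cost of a path $s$ is $C(s,\bm{x})=\sum_{e\in s}c_e(f_e(\bm{x}))$. An information constrained user equilibrium (ICUE) is an outcome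 $\bm{x}$ such that for every type $(i,k)$ and all $s,s'\in S_{ik}$ with $x^{ik}_s>0$, $C(s,\bm{x})\le C(s',\bm{x})$. The equilibrium cost of type $(i,k)$ is $C_{ik}(\bm{x})=\min_{s\in S_{ik}}C(s,\bm{x})$. IBP occurs if, for expanded information sets $\tilde E_{ik}$ with $E_{11}\subset\tilde E_{11}$ and $\tilde E_{ik}=E_{ik}$ for $(i,k)\ne(1,1)$, there are ICUE $\bm{x}$ (original sets) and $\tilde{\bm{x}}$ (expanded sets) with $C_{11}(\bm{x})<C_{11}(\tilde{\bm{x}})$; immunity means this never occurs. A circuit game is one in which every population's relevant network $G_i$ is a circuit, i.e., its edges form a single cycle.
   Formalization: Since edge costs may equal ∞, the claim as stated can fail; it is proved under the added assumption that in both equilibria every path carrying positive flow has finite cost, which is automatic when edge costs are finite. *)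

(* Defs.v *)
From HB Require Import structures.
From mathcomp Require Import all_boot all_order all_algebra.
From mathcomp Require Import all_classical all_reals all_analysis.

Set Implicit Arguments.
Unset Strict Implicit.
Unset Printing Implicit Defensive.

Import Order.TTheory GRing.Theory Num.Theory.
Import numFieldNormedType.Exports.

Local Open Scope ring_scope.

(* Everything in the model except the information sets, which are passed
   separately because they are what an expansion changes.  The network is a
   multigraph: parallel edges (hence circuits of length two) are allowed.  An
   edge cost is only constrained, and only ever evaluated, on nonnegative
   loads.  An information type (i, k) with k in K_i is a dependent pair. *)
Record game (R : realType) := Game {
  vertex : finType;
  edge : finType;
  endpoints : edge -> vertex * vertex;
  population : finType;
  origin : population -> vertex;
  destination : population -> vertex;
  origin_destination_inj : injective (fun i => (origin i, destination i));
  type_index : population -> finType;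
  demand : {i : population & type_index i} -> R;
  demand_ge0 : forall t, 0 <= demand t;
  edge_cost : edge -> R -> \bar R;
  edge_cost_ge0 : forall e (r : R), 0 <= r -> (0 <= edge_cost e r)%E;
  edge_cost_nondecreasing : forall e (r s : R),
    0 <= r -> r <= s -> (edge_cost e r <= edge_cost e s)%E;
  edge_cost_continuous : forall e,
    {within [set r : R | 0 <= r], continuous (edge_cost e)}%classic }.

Definition info_type (R : realType) (g : game R) : finType :=
  {i : population g & type_index i}.

Section Model.

Variables (R : realType) (g : game R).

Local Notation V := (vertex g).
Local Notation E := (edge g).

Definition joins (e : E) (u v : V) : bool :=
  (endpoints e == (u, v)) || (endpoints e == (v, u)).

(* A walk from u is the sequence of its steps (edge taken, vertex reached). *)
Fixpoint walk (u : V) (p : seq (E * V)) (v : V) : bool :=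
  if p is (e, w) :: p' then joins e u w && walk w p' v else u == v.

(* A simple path with given ends is identified with its set of edges, which
   determines it. *)
Definition simple_path (u v : V) (s : {set E}) : Prop :=
  exists p : seq (E * V),
    [/\ walk u p v, uniq (u :: unzip2 p) & s = [set e in unzip1 p]].

(* Distinctness of the edges only matters for closed walks of length two. *)
Definition single_cycle (F : {set E}) : Prop :=
  exists (u : V) (p : seq (E * V)),
    [/\ p != [::], walk u p u, uniq (unzip2 p), uniq (unzip1 p)
      & F = [set e in unzip1 p]].

Definition relevant_edges (i : population g) : {set E} :=
  [set e | `[< exists2 s, simple_path (origin i) (destination i) s
                        & e \in s >]].

Definition circuit_game : Prop :=
  forall i : population g, single_cycle (relevant_edges i).

Definition strategies (I : info_type g -> {set E}) (t : info_type g) :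
    {set {set E}} :=
  [set s | `[< simple_path (origin (tag t)) (destination (tag t)) s >]
           && (s \subset I t)].

Definition information_sets (I : info_type g -> {set E}) : Prop :=
  forall t, I t \subset relevant_edges (tag t) /\
    exists s, s \in strategies I t.

(* Only the values x t s with s in strategies I t are meaningful. *)
Definition outcome (I : info_type g -> {set E})
    (x : info_type g -> {set E} -> R) : Prop :=
  forall t, (forall s, s \in strategies I t -> 0 <= x t s) /\
            \sum_(s in strategies I t) x t s = demand t.

Definition load (I : info_type g -> {set E})
    (x : info_type g -> {set E} -> R) (e : E) : R :=
  \sum_(t : info_type g) \sum_(s in strategies I t | e \in s) x t s.

Definition path_cost (I : info_type g -> {set E})
    (x : info_type g -> {set E} -> R) (s : {set E}) : \bar R :=
  (\sum_(e in s) edge_cost e (load I x e))%E.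

Definition ICUE (I : info_type g -> {set E})
    (x : info_type g -> {set E} -> R) : Prop :=
  outcome I x /\
  forall t s s', s \in strategies I t -> s' \in strategies I t ->
    0 < x t s -> (path_cost I x s <= path_cost I x s')%E.

(* The default +oo is neutral, so this is the minimum over strategies I t
   whenever that set is nonempty. *)
Definition equilibrium_cost (I : info_type g -> {set E})
    (x : info_type g -> {set E} -> R) (t : info_type g) : \bar R :=
  \big[Order.min/+oo%E]_(s in strategies I t) path_cost I x s.

(* Automatic when the edge costs are finite.  Without it, a type all of whose
   paths cost +oo may be routed arbitrarily at an ICUE. *)
Definition finite_used_costs (I : info_type g -> {set E})
    (x : info_type g -> {set E} -> R) : Prop :=
  forall t s, s \in strategies I t -> 0 < x t s ->
    (path_cost I x s < +oo)%E.

Definition expansion (t1 : info_type g) (I J : info_type g -> {set E}) : Prop :=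
  I t1 \subset J t1 /\ forall t, t != t1 -> J t = I t.

End Model.

(* Main.v *)
Require Import Defs.
From mathcomp Require Import all_boot all_order all_algebra.
From mathcomp Require Import all_classical all_reals all_analysis.
From mathcomp Require Import lra.

(** If population i's relevant network is a circuit, then that circuit is a block
    of the network: another circuit sharing an edge with it, but not all of it,
    would provide a detour, hence a third simple path.  So the circuits of two
    populations are equal or edge-disjoint, and each type on a circuit C chooses
    between complementary arcs of C.

    Let mu_e be the change of the cost of edge e from x to y, and suppose that
    mu(P) > 0 for a strategy P of the expanding type.  Any other type that shifts
    flow from an arc A to its complement has mu(A) >= mu(C - A).  Call psi
    compatible if it has the sign of mu wherever it is nonzero and
    psi(A) >= psi(C - A) for each such shift: pairing psi with the change of the
    loads, which is increasing in mu, shows that psi = 0 on C.  If the expanding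
    type does not shift, or mu(C - P) <= mu(P), then psi = mu is compatible, a
    contradiction.  Otherwise t = mu(C) > 0, and the signed crossings of a
    suitable lattice of levels of step t/2 by the partial sums of mu around C
    form a compatible psi with psi(C) = 2, again a contradiction. *)

Set Implicit Arguments.
Unset Strict Implicit.
Unset Printing Implicit Defensive.

Import Order.TTheory GRing.Theory Num.Theory.

(** * Simple paths in circuits *)

Definition cyclic_arc (T : finType) (c : seq T) (s : {set T}) : Prop :=
  exists c1 c2 c3, c = c1 ++ c2 ++ c3 /\
    (s = [set e in c2] \/ s = [set e in c1 ++ c3]).

Section Graph.

Variables (R : realType) (g : game R).
Local Notation V := (vertex g).
Local Notation E := (edge g).
Implicit Types (u v w x a b : V) (e f : E) (p : seq (E * V)) (s A C : {set E}).

Definition incidence e x : bool :=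
  ((endpoints e).1 == x) (+) ((endpoints e).2 == x).

Lemma incidence_joins e u w x :
  joins e u w -> incidence e x = (u == x) (+) (w == x).
Proof. by rewrite /incidence => /orP[]/eqP-> //=; rewrite addbC. Qed.

Definition boundary s x : bool := \big[addb/false]_(e in s) incidence e x.

Lemma walk_cat u p q v : walk u (p ++ q) v =
  walk u p (last u (unzip2 p)) && walk (last u (unzip2 p)) q v.
Proof.
elim: p u => [|[e w] p IH] u /=; first by rewrite eqxx.
by rewrite IH andbA.
Qed.

Lemma walk_last u p v : walk u p v -> last u (unzip2 p) = v.
Proof. by elim: p u => [|[e w] p IH] u /= => [/eqP|/andP[_ /IH]]. Qed.

Lemma walk_endpoint u p v e x w :
  walk u p v -> e \in unzip1 p -> joins e x w -> x \in u :: unzip2 p.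
Proof.
elim: p u => [|[f z] p IH] u //= /andP[jf wp].
rewrite inE => /predU1P[-> jx|ep jx]; last by rewrite inE (IH _ wp ep jx) orbT.
move: jf jx; rewrite /joins !inE.
by move=> /orP[]/eqP-> /orP[]/eqP[? ?]; subst; rewrite eqxx ?orbT.
Qed.

Lemma walk_incidence0 u p v e x :
  walk u p v -> e \in unzip1 p -> x \notin u :: unzip2 p -> incidence e x = false.
Proof.
move=> wp ep xp; rewrite /incidence.
case: (eqVneq (endpoints e).1 x) => [ex|_].
  case/negP: xp; apply: (walk_endpoint (w := (endpoints e).2) wp ep).
  by rewrite /joins -ex -surjective_pairing eqxx.
case: (eqVneq (endpoints e).2 x) => [ex|//].
case/negP: xp; apply: (walk_endpoint (w := (endpoints e).1) wp ep).
by rewrite /joins -ex -surjective_pairing eqxx orbT.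
Qed.

Lemma boundary_walk u p v x : walk u p v -> uniq (unzip1 p) ->
  boundary [set e in unzip1 p] x = (u == x) (+) (v == x).
Proof.
move=> wp up; rewrite /boundary.
under eq_bigl do rewrite inE.
rewrite -big_uniq //= {up}; elim: p u wp => [|[e w] p IH] u /=.
  by move=> /eqP->; rewrite big_nil addbb.
move=> /andP[je wp]; rewrite big_cons (IH w) // (incidence_joins _ je).
by rewrite -addbA (addbA (w == x)) addbb.
Qed.

Lemma walk_uniq_edges u p v :
  walk u p v -> uniq (u :: unzip2 p) -> uniq (unzip1 p).
Proof.
elim: p u => [|[e w] p IH] u // /andP[je wp] /andP[up uw].
rewrite /= (IH w) // andbT; apply: contra up => ep.
exact: walk_endpoint wp ep je.
Qed.

Lemma boundary_simple_path a b s x :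
  simple_path a b s -> boundary s x = (a == x) (+) (b == x).
Proof.
by move=> [p [wp up ->]]; apply: boundary_walk => //; apply: walk_uniq_edges wp up.
Qed.

Lemma simple_path_loop a s : simple_path a a s -> s = finset.set0.
Proof.
move=> [[|[e w] p] [wp + ->]]; first by move=> _; apply/finset.setP=> e; rewrite !inE.
by rewrite /= -{1}(walk_last wp) /= mem_last.
Qed.

Lemma boundary_const (h : pred E) u e w p v :
  walk u ((e, w) :: p) v -> uniq (w :: unzip2 p) ->
  u \notin belast w (unzip2 p) ->
  (forall x, x \in belast w (unzip2 p) ->
    \big[addb/false]_(f <- e :: unzip1 p) (h f && incidence f x) = false) ->
  forall f, f \in unzip1 p -> h f = h e.
Proof.
elim: p u e w => [|[e' w'] p IH] u e w //.
rewrite [walk _ _ _]/= => /and3P[je je' wp] /andP[wn un].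
rewrite [belast _ _]/= inE negb_or => /andP[uw ub] h0 f.
have he : h e' = h e.
  have := h0 w (mem_head _ _).
  rewrite !big_cons /= big1_seq => [|d /andP[_ dp]].
    rewrite (incidence_joins _ je) (incidence_joins _ je') eqxx (negbTE uw).
    move: wn; rewrite inE negb_or eq_sym => /andP[/negbTE-> _].
    by rewrite !andbT addbF; case: (h e); case: (h e').
  by rewrite (walk_incidence0 wp dp) ?andbF.
rewrite inE => /predU1P[->//|fp]; rewrite -he.
apply: (IH w e' w') => //; first by rewrite /= je'.
  by apply: contra wn; apply: mem_belast.
move=> x xb; have := h0 x; rewrite inE xb orbT => /(_ isT).
rewrite big_cons (incidence_joins _ je).
have -> : (u == x) = false by apply: contraNF ub => /eqP->.
have -> : (w == x) = false by apply: contraNF wn => /eqP->; apply: mem_belast.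
by rewrite andbF.
Qed.

Lemma boundaryE s x :
  boundary s x = \big[addb/false]_e ((e \in s) && incidence e x).
Proof. by rewrite /boundary big_mkcond; apply: eq_bigr => e _; case: ifP. Qed.

Lemma boundary_cycle C x : single_cycle C -> boundary C x = false.
Proof. by move=> [u [p [_ wp _ up ->]]]; rewrite (boundary_walk _ wp up) addbb. Qed.

Lemma cycle_neq0 C : single_cycle C -> exists e, e \in C.
Proof.
by move=> [u [[|[e w] p] []]] // _ _ _ _ ->; exists e; rewrite !inE eqxx.
Qed.

Lemma cycle_rigid C s s' : single_cycle C -> s \subset C -> s' \subset C ->
  boundary s =1 boundary s' -> s' = s \/ s' = C :\: s.
Proof.
move=> [u [[|[e w] p] []]] // _ wp uv ue -> sC s'C bs.
pose h e := (e \in s) (+) (e \in s').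
have hE f : f \notin e :: unzip1 p -> h f = false.
  move=> fC; rewrite /h; have -> : f \in s = false.
    by apply: contraNF fC => /(fintype.subsetP sC); rewrite inE.
  by apply: contraNF fC => /(fintype.subsetP s'C); rewrite inE.
have hc : forall f, f \in unzip1 p -> h f = h e.
  apply: (boundary_const wp uv).
    have := uv; rewrite /= -[_ && _]/(uniq (w :: unzip2 p)) lastI rcons_uniq.
    by have /= -> := walk_last wp; case/andP.
  move=> x _; have : boundary s x (+) boundary s' x = false by rewrite bs addbb.
  rewrite !boundaryE -big_split /= => bb.
  rewrite [LHS]big_uniq // -[RHS]bb [LHS]big_mkcond; apply: eq_bigr => f _ /=.
  rewrite -andb_addl -/(h f); case: ifPn => // /hE -> //.
have hE' f : f \in e :: unzip1 p -> h f = h e.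
  by rewrite inE => /predU1P[->|/hc].
case he: (h e); [right|left]; apply/finset.setP => f.
  rewrite !inE /=; case: (boolP (f \in e :: unzip1 p)) => fC.
    rewrite -in_cons fC andbT; have := hE' _ fC; rewrite he /h.
    by case: (f \in s); case: (f \in s').
  rewrite -in_cons (negbTE fC) andbF.
  by apply: contraNF fC => /(fintype.subsetP s'C); rewrite inE.
have : h f = false.
  by case: (boolP (f \in e :: unzip1 p)) => fC; [rewrite hE'|rewrite hE].
by rewrite /h; case: (f \in s); case: (f \in s').
Qed.

Definition adjacent A : rel V := fun u v => [exists e in A, joins e u v].

Lemma connect_adjacent_sym A : connect_sym (adjacent A).
Proof.
apply: sym_connect_sym => u v; apply: eq_existsb => e; congr (_ && _).
by rewrite /joins orbC.
Qed.

Lemma walk_connect A u p v : walk u p v ->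
  (forall e, e \in unzip1 p ->
    connect (adjacent A) (endpoints e).1 (endpoints e).2) ->
  connect (adjacent A) u v.
Proof.
elim: p u => [|[e w] p IH] u /=; first by move=> /eqP->.
move=> /andP[je wp] h; apply: (@connect_trans _ _ w); last first.
  by apply: IH => // f fp; apply: h; rewrite inE fp orbT.
by have := h _ (mem_head _ _); case/orP: je => /eqP-> //=; rewrite connect_adjacent_sym.
Qed.

Lemma adjacent_endpoints A e : e \in A ->
  connect (adjacent A) (endpoints e).1 (endpoints e).2.
Proof.
move=> eA; apply: connect1; apply/existsP; exists e.
by rewrite eA /joins -surjective_pairing eqxx.
Qed.

Lemma connect_simple_path A a b : connect (adjacent A) a b ->
  exists2 s, simple_path a b s & s \subset A.
Proof.
case/connectP => q0 /shortenP[q pq uq _] -> {b q0}.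
have [p [wp pE pA]] : exists p, [/\ walk a p (last a q), unzip2 p = q &
    {subset unzip1 p <= A}].
  elim: q a pq {uq} => [|w q IH] a /=; first by move=> _; exists [::]; split=> //=.
  move=> /andP[/existsP[e /andP[eA je]] /IH[p [wp pE pA]]].
  exists ((e, w) :: p); split; rewrite /= ?je ?pE //.
  by move=> f; rewrite inE => /predU1P[->//|/pA].
exists [set e in unzip1 p]; first by exists p; split; rewrite ?pE.
by apply/fintype.subsetP => f; rewrite inE => /pA.
Qed.

Lemma cycle_connect C e : single_cycle C -> e \in C ->
  connect (adjacent (C :\ e)) (endpoints e).1 (endpoints e).2.
Proof.
move=> [u [p [_ wp _ ue ->]]]; rewrite inE => /mapP[[f w] /= fp ef].
move: wp ue; case/splitPr: p / fp => p1 p2; rewrite walk_cat /=.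
move=> /and3P[w1 je w2]; rewrite /unzip1 map_cat cat_uniq /= -ef.
rewrite -ef in je.
move=> /and3P[_ /norP[e1 _] /andP[e2 _]].
set A := [set _ in _] :\ e.
have c : connect (adjacent A) w (last u (unzip2 p1)).
  apply: (@connect_trans _ _ u).
    apply: (walk_connect w2) => d dp; apply: adjacent_endpoints.
    rewrite !inE mem_cat inE dp !orbT andbT.
    by apply: contraNneq e2 => <-.
  apply: (walk_connect w1) => d dp; apply: adjacent_endpoints.
  rewrite !inE mem_cat dp andbT.
  by apply: contraNneq e1 => <-.
by case/orP: je => /eqP -> //=; rewrite connect_adjacent_sym.
Qed.

Lemma walk_split u p a : a \in unzip2 p ->
  exists2 i, i <= size p & last u (unzip2 (take i p)) = a.
Proof.
elim: p u => [|[e w] p IH] u //=; rewrite inE => /predU1P[->|/(IH w)[i ip ia]].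
  by exists 1; rewrite //= take0.
by exists i.+1.
Qed.

Lemma simple_path_cyclic_arc u p a b s : walk u p u -> p != [::] -> uniq (unzip2 p) ->
  uniq (unzip1 p) -> a != b -> s \subset [set e in unzip1 p] ->
  simple_path a b s -> cyclic_arc (unzip1 p) s.
Proof.
move=> wp p0 uv ue ab sC /boundary_simple_path bs.
have on x : boundary s x -> x \in unzip2 p.
  move=> bx; apply/negPn/negP => xp; move: bx; rewrite /boundary big1 // => e es.
  have ep : e \in unzip1 p by have := fintype.subsetP sC _ es; rewrite inE.
  rewrite (walk_incidence0 wp ep) // inE negb_or xp andbT.
  apply: contraNneq xp => ->; rewrite -(walk_last wp).
  by case: (p) p0 => [//|[f z] q] _ /=; apply: mem_last.
have /(walk_split u)[i ip ia] : a \in unzip2 p.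
  by apply: on; rewrite bs eqxx eq_sym (negbTE ab).
have /(walk_split u)[j jp jb] : b \in unzip2 p.
  by apply: on; rewrite bs eqxx (negbTE ab).
have cyc : single_cycle [set e in unzip1 p] by exists u, p.
wlog ij : a b i j bs ip jp ia jb ab / i <= j.
  move=> W; case: (leqP i j) => [|/ltnW] ij; first exact: (W a b i j).
  by apply: (W b a j i) => //; [move=> x; rewrite bs addbC|rewrite eq_sym].
have pE : p = take i p ++ take (j - i) (drop i p) ++ drop j p.
  have -> : drop j p = drop (j - i) (drop i p) by rewrite drop_drop subnK.
  by rewrite !cat_take_drop.
set p2 := take (j - i) _ in pE.
have tj : take j p = take i p ++ p2 by rewrite -(subnKC ij) takeD.
have w2 : walk a p2 b.
  move: wp; rewrite {1}pE walk_cat walk_cat ia => /and3P[_ w2 _].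
  by move: w2; rewrite -ia -last_cat -map_cat -tj jb.
exists (unzip1 (take i p)), (unzip1 p2), (unzip1 (drop j p)).
split; first by rewrite {1}pE /unzip1 !map_cat.
have ue' := ue; rewrite pE /unzip1 !map_cat cat_uniq in ue'.
case/and3P: ue' => _ h1; rewrite cat_uniq => /and3P[u2 h2 _].
have pC : [set e in unzip1 p2] \subset [set e in unzip1 p].
  apply/fintype.subsetP => e; rewrite !inE [in X in _ -> X]pE /unzip1 !map_cat.
  by rewrite !mem_cat => ->; rewrite orbT.
have bE : boundary [set e in unzip1 p2] =1 boundary s.
  by move=> x; rewrite bs; exact: boundary_walk.
have [->|->] := cycle_rigid cyc pC sC bE.
  by left.
right; apply/finset.setP => e; rewrite !inE [in X in _ && X]pE /unzip1 !map_cat !mem_cat.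
case: (boolP (e \in _)) => //= e2.
apply/esym/negbTE; rewrite negb_or; apply/andP; split.
  by apply: contra h1 => e1; apply/hasP; exists e => //; rewrite mem_cat e2.
by apply: contra h2 => e1; apply/hasP; exists e.
Qed.

Section Circuit.
Hypothesis circ : circuit_game g.
Implicit Types i j : population g.

Lemma simple_path_sub i s :
  simple_path (origin i) (destination i) s -> s \subset relevant_edges i.
Proof.
by move=> ss; apply/fintype.subsetP => e es; rewrite inE; apply/asboolP; exists s.
Qed.

Lemma relevant_simple_path i e : e \in relevant_edges i ->
  exists2 s, simple_path (origin i) (destination i) s & e \in s.
Proof. by rewrite inE => /asboolP. Qed.

Lemma origin_neq_destination i : origin i != destination i.
Proof.
have [e /relevant_simple_path[s + es]] := cycle_neq0 (circ i).
by apply: contraPneq => <- /simple_path_loop s0; rewrite s0 inE in es.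
Qed.

Lemma simple_path_eqVcompl i s s' :
  simple_path (origin i) (destination i) s ->
  simple_path (origin i) (destination i) s' ->
  s' = s \/ s' = relevant_edges i :\: s.
Proof.
move=> ss ss'; apply: (cycle_rigid (circ i)); try exact: simple_path_sub.
by move=> x; rewrite !(boundary_simple_path _ ss, boundary_simple_path _ ss').
Qed.

Lemma simple_path_proper i s : simple_path (origin i) (destination i) s ->
  exists2 e, e \in relevant_edges i & e \notin s.
Proof.
move=> ss; suff : ~~ (relevant_edges i \subset s).
  by move/fintype.subsetPn.
apply/negP => Cs; have sC : s = relevant_edges i.
  by apply/eqP; rewrite finset.eqEsubset simple_path_sub.
have := boundary_cycle (origin i) (circ i).
rewrite -sC (boundary_simple_path _ ss) eqxx eq_sym.
by rewrite (negbTE (origin_neq_destination i)).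
Qed.

(* Were [f] not on the circuit of [i], the rest of that circuit would be a
   detour around [e] that avoids [f]. *)
Lemma relevant_compl_sub i j e s :
  simple_path (origin j) (destination j) s -> e \in s ->
  e \in relevant_edges i -> relevant_edges j :\: s \subset relevant_edges i.
Proof.
move=> ss es ei; apply/fintype.subsetP => f; rewrite inE => /andP[fs fj].
apply/negPn/negP => fi; pose A := ~: [set e; f].
have [s' ss' s'A] : exists2 s', simple_path (origin j) (destination j) s' & s' \subset A.
  apply: connect_simple_path; case: ss => p [wp _ sE].
  apply: (walk_connect wp) => d dp; have [->|de] := eqVneq d e; last first.
    apply: adjacent_endpoints; rewrite !inE negb_or de.
    by apply: contraNneq fs => <-; rewrite sE inE.
  apply: connect_sub (cycle_connect (circ i) ei) => x y.
  move=> /existsP[c /andP[]]; rewrite !inE => /andP[ce ci] jc.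
  apply: connect1; apply/existsP; exists c; rewrite !inE negb_or ce jc andbT /=.
  by apply: contraNneq fi => <-; rewrite inE.
have [s'E|s'E] := simple_path_eqVcompl ss ss'.
  have := fintype.subsetP s'A e; rewrite s'E es => /(_ isT).
  by rewrite !inE eqxx.
have := fintype.subsetP s'A f; rewrite s'E inE fs fj => /(_ isT).
by rewrite !inE eqxx orbT.
Qed.

Lemma relevant_edges_eq i j e : e \in relevant_edges i ->
  e \in relevant_edges j -> relevant_edges i = relevant_edges j.
Proof.
move=> ei ej; have [s ss es] := relevant_simple_path ej.
have sub1 := relevant_compl_sub ss es ei.
have [f fj fs] := simple_path_proper ss.
have [s' ss' fs'] := relevant_simple_path fj.
have s'E : s' = relevant_edges j :\: s.
  by case: (simple_path_eqVcompl ss ss') => // s'E; rewrite -s'E fs' in fs.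
have fi : f \in relevant_edges i by apply: (fintype.subsetP sub1); rewrite -s'E.
have sub2 := relevant_compl_sub ss' fs' fi.
have ji : relevant_edges j \subset relevant_edges i.
  apply/fintype.subsetP => d dj; case: (boolP (d \in s)) => ds.
    by apply: (fintype.subsetP sub2); rewrite s'E finset.in_setD finset.in_setD ds dj.
  by apply: (fintype.subsetP sub1); rewrite finset.in_setD ds.
have := cycle_rigid (circ i) (finset.sub0set _) ji.
case => [x|jE|->]; last by rewrite finset.setD0.
  by rewrite (boundary_cycle _ (circ j)) /boundary big_set0.
by rewrite jE inE in fj.
Qed.

Lemma relevant_arcs i : exists es : seq E,
  [/\ uniq es, relevant_edges i = [set e in es] & forall j s,
    relevant_edges j = relevant_edges i ->
    simple_path (origin j) (destination j) s -> cyclic_arc es s].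
Proof.
have [u [p [p0 wp uv ue CE]]] := circ i.
exists (unzip1 p); split=> // j s ji ss.
apply: (simple_path_cyclic_arc wp p0 uv ue (origin_neq_destination j) _ ss).
by rewrite -CE -ji simple_path_sub.
Qed.

End Circuit.

End Graph.

Local Open Scope ring_scope.

(** * Level crossings around a cycle *)

Section Levels.
Variables (R : realType) (T : finType).
Implicit Types (c : seq T) (F mu : T -> R) (A B : {set T}).

Lemma sum_set_seq c F : uniq c -> \sum_(e in [set e in c]) F e = \sum_(e <- c) F e.
Proof.
by move=> uc; rewrite (big_uniq _ uc); apply: eq_bigl => e; rewrite inE.
Qed.

Definition psum c F k : R := \sum_(e <- take k c) F e.

Lemma arc_sum c B : uniq c -> cyclic_arc c B -> exists i j,
  (forall F, \sum_(e in B) F e = psum c F j - psum c F i) \/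
  (forall F, \sum_(e in B) F e = \sum_(e <- c) F e - (psum c F j - psum c F i)).
Proof.
move=> uc [c1 [c2 [c3 [cE BE]]]]; exists (size c1), (size (c1 ++ c2)).
have uc' := uc; rewrite cE cat_uniq in uc'; case/and3P: uc' => u1 h1.
rewrite cat_uniq => /and3P[u2 h2 u3].
have pi F : psum c F (size c1) = \sum_(e <- c1) F e.
  by rewrite /psum cE take_size_cat.
have pj F : psum c F (size (c1 ++ c2)) = \sum_(e <- c1) F e + \sum_(e <- c2) F e.
  by rewrite /psum cE catA take_size_cat // big_cat.
case: BE => ->; [left|right] => F; rewrite pi pj.
  by rewrite sum_set_seq // addrC addKr.
rewrite sum_set_seq ?cE ?big_cat /=; first by lra.
rewrite cat_uniq u1 u3 andbT; apply: contra h1 => /hasP[e e3 e1].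
by apply/hasP; exists e => //; rewrite mem_cat e3 orbT.
Qed.


Lemma psum_index c F e : e \in c ->
  psum c F (index e c).+1 = psum c F (index e c) + F e.
Proof.
by move=> ec; rewrite /psum (take_nth e) ?index_mem // nth_index // -cats1
  big_cat big_seq1.
Qed.

Definition increment (N : R -> R) c mu e : R :=
  N (psum c mu (index e c).+1) - N (psum c mu (index e c)).

Lemma psum_increment N c mu k : uniq c ->
  psum c (increment N c mu) k = N (psum c mu k) - N 0.
Proof.
move=> uc; elim: k => [|k IH]; first by rewrite /psum take0 !big_nil subrr.
case: (ltnP k (size c)) => kc; last first.
  by move: IH; rewrite /psum !take_oversize // ltnW.
have [e ec ei] : exists2 e, e \in c & index e c = k.
  case: c uc kc {IH} => // x0 c uc kc.
  by exists (nth x0 (x0 :: c) k); [exact: mem_nth|exact: index_uniq].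
rewrite -ei psum_index // ei IH /increment ei; lra.
Qed.

Lemma psum_size c F : psum c F (size c) = \sum_(e <- c) F e.
Proof. by rewrite /psum take_size. Qed.

Definition level (t k r : R) : R := (Num.floor ((r - k) / (t / 2)))%:~R.

Lemma level_le t k r s : 0 < t -> r <= s -> level t k r <= level t k s.
Proof.
move=> t0 rs; rewrite ler_int le_floor // ler_pM2r ?lerD2r //.
by rewrite invr_gt0 divr_gt0.
Qed.

Lemma levelD t k r : 0 < t -> level t k (r + t / 2) = level t k r + 1.
Proof.
move=> t0; rewrite /level -[X in _ = _ + X]/(1%:~R) -intrD; congr (_%:~R).
have -> : (r + t / 2 - k) / (t / 2) = (r - k) / (t / 2) + 1.
  have t2 : t / 2 != 0 by rewrite gt_eqF // divr_gt0.
  by rewrite addrAC mulrDl divff.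
by rewrite floorDrz ?floor1.
Qed.

Lemma level_self t k : level t k k = 0.
Proof. by rewrite /level subrr mul0r floor0. Qed.

Lemma level_lt t k r : 0 < t -> r < k -> level t k r <= -1.
Proof.
move=> t0 rk; rewrite /level -[X in _ <= X]/((-1)%:~R) ler_int.
rewrite -ltzD1 addNr floor_lt0 pmulr_llt0 ?subr_lt0 //.
by rewrite invr_gt0 divr_gt0.
Qed.

(* Record the levels [k + m * t / 2], [m] an integer, crossed by the partial
   sums of [mu] around the cycle, [t] being their total: a turn crosses two
   levels net, an arc of measure at least [t / 2] crosses at least one, and [k]
   is chosen so that the arc [A] also crosses at least one. *)
Lemma arc_level_crossing c mu A : uniq c -> cyclic_arc c A ->
  0 < \sum_(e <- c) mu e -> 0 < \sum_(e in A) mu e ->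
  exists psi : T -> R, [/\
    forall e, e \in c -> 0 < psi e -> 0 < mu e,
    forall e, e \in c -> psi e < 0 -> mu e < 0,
    \sum_(e <- c) psi e = 2,
    1 <= \sum_(e in A) psi e &
    forall B, cyclic_arc c B -> (\sum_(e <- c) mu e) / 2 <= \sum_(e in B) mu e ->
      1 <= \sum_(e in B) psi e].
Proof.
move=> uc cA; set t := \sum_(e <- c) mu e => t0 A0.
have lvl2 k r : level t k (r + t) = level t k r + 2.
  have -> : r + t = r + t / 2 + t / 2 by lra.
  by rewrite !levelD //; lra.
have tot k : \sum_(e <- c) increment (level t k) c mu e = 2.
  rewrite -psum_size psum_increment // psum_size -/t.
  by rewrite -[X in level t k X]add0r lvl2; lra.
have [k Ak] : exists k, 1 <= \sum_(e in A) increment (level t k) c mu e.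
  have [i [j [AE|AE]]] := arc_sum uc cA; rewrite AE in A0.
    exists (psum c mu j); rewrite AE !psum_increment // level_self.
    have ij : psum c mu i < psum c mu j by lra.
    have := level_lt t0 ij; lra.
  exists (psum c mu i); rewrite AE tot !psum_increment // level_self.
  have ij : psum c mu j - t < psum c mu i by rewrite -/t in A0; lra.
  have := level_lt t0 ij; rewrite -[psum c mu j in X in _ -> X](subrK t) lvl2; lra.
exists (increment (level t k) c mu); split => //.
- move=> e ec; rewrite /increment psum_index //; apply: contraTT.
  rewrite -!leNgt => me; rewrite subr_le0 level_le //; lra.
- move=> e ec; rewrite /increment psum_index //; apply: contraTT.
  rewrite -!leNgt => me; rewrite subr_ge0 level_le //; lra.
move=> B cB tB; have [i' [j' [BE|BE]]] := arc_sum uc cB.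
  rewrite BE in tB; rewrite BE !psum_increment //.
  have := @level_le t k (psum c mu i' + t / 2) (psum c mu j') t0.
  rewrite levelD //; lra.
rewrite BE -/t in tB; rewrite BE !psum_increment // tot.
have := @level_le t k (psum c mu j') (psum c mu i' + t / 2) t0.
rewrite levelD //; lra.
Qed.

End Levels.

(** * Flows and costs *)

Section Flows.

Variables (R : realType) (g : game R).
Local Notation E := (edge g).
Local Notation info := (info_type g -> {set E}).
Local Notation assignment := (info_type g -> {set E} -> R).
Implicit Types (I J : info) (x y : assignment) (t : info_type g) (s : {set E}).

Definition flow I x t s : R := if s \in strategies I t then x t s else 0.

Lemma strategies_simple_path I t s : s \in strategies I t ->
  simple_path (origin (tag t)) (destination (tag t)) s.
Proof. by rewrite inE => /andP[/asboolP]. Qed.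

Lemma flow_ge0 I x t s : outcome I x -> 0 <= flow I x t s.
Proof. by move=> /(_ t)[x0 _]; rewrite /flow; case: ifP => // /x0. Qed.

Lemma flow_gt0 I x t s : 0 < flow I x t s -> s \in strategies I t /\ 0 < x t s.
Proof. by rewrite /flow; case: ifP => // _; rewrite ltxx. Qed.

Lemma loadE I x e : load I x e = \sum_t \sum_(s : {set E} | e \in s) flow I x t s.
Proof.
apply: eq_bigr => t _; rewrite /flow -big_mkcondl.
by apply: eq_bigl => s; rewrite andbC.
Qed.

Lemma load_ge0 I x e : outcome I x -> 0 <= load I x e.
Proof.
by move=> ox; rewrite loadE; do 2![apply: sumr_ge0 => ? _]; exact: flow_ge0.
Qed.

Section Circuit.
Hypothesis circ : circuit_game g.

Lemma sum_complementary_paths t s (D w : {set E} -> R) :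
  let s' := relevant_edges (tag t) :\: s in
  simple_path (origin (tag t)) (destination (tag t)) s ->
  (forall r, ~ simple_path (origin (tag t)) (destination (tag t)) r -> D r = 0) ->
  \sum_r D r * w r = D s * w s + D s' * w s'.
Proof.
move=> s' ss D0; have s's : s' != s.
  have [e eC es] := simple_path_proper circ ss.
  apply/eqP => sE; have : e \in s' by rewrite inE es.
  by rewrite sE (negbTE es).
rewrite (bigD1 s) //= (bigD1 s') //= big1 ?addr0 // => r /andP[rs rs'].
rewrite D0 ?mul0r // => sr; case: (simple_path_eqVcompl circ ss sr) => rE.
  by rewrite rE eqxx in rs.
by rewrite rE eqxx in rs'.
Qed.

Lemma flow_eq0 I x t s :
  ~ simple_path (origin (tag t)) (destination (tag t)) s -> flow I x t s = 0.
Proof. by rewrite /flow; case: ifP => // /strategies_simple_path. Qed.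

Lemma flow_demand I x t s : outcome I x ->
  simple_path (origin (tag t)) (destination (tag t)) s ->
  flow I x t s + flow I x t (relevant_edges (tag t) :\: s) = demand t.
Proof.
move=> /(_ t)[_ <-] ss; rewrite big_mkcond /=.
have := sum_complementary_paths (fun=> 1) ss (@flow_eq0 I x t).
by rewrite !mulr1 => <-; apply: eq_bigr => r _; rewrite mulr1.
Qed.

Lemma load_shift_vanish I J x y i (psi : E -> R) :
  outcome I x -> outcome J y ->
  (forall e, e \in relevant_edges i -> 0 < psi e -> load I x e < load J y e) ->
  (forall e, e \in relevant_edges i -> psi e < 0 -> load J y e < load I x e) ->
  (forall t s, relevant_edges (tag t) = relevant_edges i ->
    simple_path (origin (tag t)) (destination (tag t)) s ->
    flow I x t s < flow J y t s ->
    \sum_(e in s) psi e <= \sum_(e in relevant_edges i :\: s) psi e) ->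
  forall e, e \in relevant_edges i -> psi e = 0.
Proof.
set C := relevant_edges i => ox oy pos neg shift.
have ge0 e : e \in C -> 0 <= psi e * (load J y e - load I x e).
  move=> eC; case: (ltrgtP (psi e) 0) => [p|p|->]; last by rewrite mul0r.
    by have := neg _ eC p; nra.
  by have := pos _ eC p; nra.
have le0 : \sum_(e in C) psi e * (load J y e - load I x e) <= 0.
  pose D t s := flow J y t s - flow I x t s.
  have D0 t r : ~ simple_path (origin (tag t)) (destination (tag t)) r -> D t r = 0.
    by move=> nr; rewrite /D !flow_eq0 // subrr.
  under eq_bigr do rewrite !loadE -sumrB mulr_sumr.
  rewrite exchange_big /=; apply: sumr_le0 => t _.
  under eq_bigr do rewrite -sumrB mulr_sumr.
  have [tC|tC] := eqVneq (relevant_edges (tag t)) C; last first.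
    rewrite big1 // => e eC; rewrite big1 // => s es.
    rewrite -[_ - _]/(D t s) D0 ?mulr0 // => ss; case/eqP: tC.
    apply: (relevant_edges_eq circ _ eC).
    exact: (fintype.subsetP (simple_path_sub ss)).
  have -> : \sum_(e in C) \sum_(s : {set E} | e \in s)
      psi e * (flow J y t s - flow I x t s) = \sum_s D t s * \sum_(e in s) psi e.
    rewrite (exchange_big_dep predT) //=; apply: eq_bigr => s _.
    case: (pselect (simple_path (origin (tag t)) (destination (tag t)) s)) => ss.
      rewrite mulr_sumr; apply: eq_big => [e|e _]; last by rewrite mulrC.
      apply: andb_idl => es; rewrite -tC.
      exact: (fintype.subsetP (simple_path_sub ss)).
    by rewrite D0 // mul0r big1 // => e _; rewrite -[_ - _]/(D t s) D0 ?mulr0.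
  have [e0 /relevant_simple_path[P sP _]] := cycle_neq0 (circ (tag t)).
  rewrite (sum_complementary_paths _ sP (D0 t)) tC.
  have := flow_demand ox sP; have := flow_demand oy sP; rewrite tC.
  case: (ltrgtP (flow I x t P) (flow J y t P)) => [lt|gt|eq] dy dx.
  - by have := shift _ _ tC sP lt; rewrite /D; nra.
  - have lt : flow I x t (C :\: P) < flow J y t (C :\: P) by lra.
    have sQ : simple_path (origin (tag t)) (destination (tag t)) (C :\: P).
      apply: contrapT => nQ.
      by move: lt; rewrite !(flow_eq0 _ _ nQ) ltxx.
    have := shift _ _ tC sQ lt.
    have -> : C :\: (C :\: P) = P.
      rewrite finset.setDDr finset.setDv finset.set0U; apply/finset.setIidPr.
      by rewrite -tC simple_path_sub.
    by rewrite /D; nra.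
  - have eqQ : flow J y t (C :\: P) = flow I x t (C :\: P) by lra.
    by rewrite /D eq eqQ !subrr !mul0r addr0.
have eq0 : \sum_(e in C) psi e * (load J y e - load I x e) = 0.
  by apply/le_anti; rewrite le0 sumr_ge0.
move=> e eC; have /eqP := psumr_eq0P ge0 eq0 eC.
rewrite mulf_eq0 => /orP[/eqP//|]; rewrite subr_eq0 => /eqP ll.
case: (ltrgtP (psi e) 0) => // p.
  by have := neg _ eC p; rewrite ll ltxx.
by have := pos _ eC p; rewrite ll ltxx.
Qed.

End Circuit.

Definition real_cost I x e : R := fine (edge_cost e (load I x e)).

Lemma edge_cost_load_ge0 I x e : outcome I x -> (0 <= edge_cost e (load I x e))%E.
Proof. by move=> ox; apply: edge_cost_ge0; exact: load_ge0. Qed.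

Lemma edge_cost_lt_path_cost I x s e : outcome I x ->
  (path_cost I x s < +oo)%E -> e \in s -> (edge_cost e (load I x e) < +oo)%E.
Proof.
move=> ox sf es; apply: le_lt_trans sf; rewrite /path_cost (bigD1 e) //=.
by rewrite leeDl // sume_ge0 // => f _; exact: edge_cost_load_ge0.
Qed.

Lemma edge_cost_loaded I x e : outcome I x -> finite_used_costs I x ->
  0 < load I x e -> (edge_cost e (load I x e) < +oo)%E.
Proof.
move=> ox fx l0; rewrite loadE in l0.
have [t [s [es fs]]] : exists t s, e \in s /\ 0 < flow I x t s.
  apply: contrapT => H; move: l0; rewrite big1 ?ltxx // => t _.
  rewrite big1 // => s es; apply/eqP; rewrite eq_le flow_ge0 // andbT.
  by rewrite leNgt; apply/negP => fs; apply: H; exists t, s.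
have [sI xs] := flow_gt0 fs.
exact: edge_cost_lt_path_cost ox (fx _ _ sI xs) es.
Qed.

Lemma path_cost_real I x s : outcome I x ->
  (forall e, e \in s -> (edge_cost e (load I x e) < +oo)%E) ->
  path_cost I x s = (\sum_(e in s) real_cost I x e)%:E.
Proof.
move=> ox sf; rewrite -sumEFin; apply: eq_bigr => e es.
by rewrite fineK // ge0_fin_numE ?sf // edge_cost_load_ge0.
Qed.

(* An edge of infinite cost carries no load, so its cost is infinite at every
   load. *)
Lemma edge_cost_lt_pinfty I J x y e : outcome I x -> outcome J y ->
  finite_used_costs I x -> (edge_cost e (load J y e) < +oo)%E ->
  (edge_cost e (load I x e) < +oo)%E.
Proof.
move=> ox oy fx; have := load_ge0 e ox; rewrite le_eqVlt => /predU1P[<-|l0 _].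
  by apply: le_lt_trans; apply: edge_cost_nondecreasing => //; exact: load_ge0.
exact: edge_cost_loaded.
Qed.

Lemma real_cost_lt I J x y e : outcome I x -> outcome J y ->
  finite_used_costs I x -> finite_used_costs J y ->
  real_cost I x e < real_cost J y e -> load I x e < load J y e.
Proof.
move=> ox oy fx fy; apply: contraTT; rewrite -!leNgt => yx.
case: (ltP (edge_cost e (load I x e)) +oo%E) => [xf|xi].
  have yf := edge_cost_lt_pinfty oy ox fy xf.
  apply: fine_le; rewrite ?ge0_fin_numE ?edge_cost_load_ge0 //.
  by apply: edge_cost_nondecreasing => //; exact: load_ge0.
suff yi : (+oo <= edge_cost e (load J y e))%E.
  by move: xi yi; rewrite !leye_eq /real_cost => /eqP-> /eqP->.
rewrite leNgt; apply/negP => /(edge_cost_lt_pinfty ox oy fx).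
by rewrite ltNge xi.
Qed.

Lemma path_cost_real_shift I J x y s : outcome I x -> outcome J y ->
  finite_used_costs J y -> (path_cost I x s < +oo)%E ->
  path_cost I x s = (\sum_(e in s) real_cost I x e)%:E /\
  path_cost J y s = (\sum_(e in s) real_cost J y e)%:E.
Proof.
move=> ox oy fy sf; have ef e es := edge_cost_lt_path_cost (e := e) ox sf es.
split; apply: path_cost_real => // e es.
exact: edge_cost_lt_pinfty oy ox fy (ef e es).
Qed.

Lemma ICUE_shift I J x y t s s' : ICUE I x -> ICUE J y ->
  finite_used_costs I x -> finite_used_costs J y ->
  strategies I t = strategies J t -> s \in strategies I t ->
  s' \in strategies I t -> 0 < x t s' -> 0 < y t s ->
  \sum_(e in s) (real_cost J y e - real_cost I x e) <=
  \sum_(e in s') (real_cost J y e - real_cost I x e).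
Proof.
move=> [ox ex] [oy ey] fx fy IJ sI s'I xs' ys.
have [sJ s'J] : s \in strategies J t /\ s' \in strategies J t by rewrite -IJ.
have [sy sx] := path_cost_real_shift oy ox fx (fy _ _ sJ ys).
have [s'x s'y] := path_cost_real_shift ox oy fy (fx _ _ s'I xs').
have := ex t s' s s'I sI xs'; have := ey t s s' sJ s'J ys.
rewrite sx sy s'x s'y !lee_fin !sumrB; lra.
Qed.

End Flows.

Theorem theorem3 (R : realType) (g : game R) (t1 : info_type g)
    (I J : info_type g -> {set edge g})
    (x y : info_type g -> {set edge g} -> R) :
  circuit_game g ->
  information_sets I ->
  information_sets J ->
  expansion t1 I J ->
  ICUE I x ->
  ICUE J y ->
  finite_used_costs I x ->
  finite_used_costs J y ->
  (equilibrium_cost J y t1 <= equilibrium_cost I x t1)%E.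
Proof.
move=> circ _ _ [IJ1 IJ] ex ey fx fy; have [ox _] := ex; have [oy _] := ey.
apply: le_bigmin => [|P PI]; first by rewrite leey.
have sP := strategies_simple_path PI.
have PJ : P \in strategies J t1.
  by move: PI; rewrite !inE => /andP[-> PI]; exact: fintype.subset_trans PI IJ1.
apply: (le_trans (bigmin_le_cond _ _ PJ)); rewrite leNgt; apply/negP => Plt.
pose mu e := real_cost J y e - real_cost I x e.
have muP : 0 < \sum_(e in P) mu e.
  have [xP yP] := path_cost_real_shift ox oy fy (lt_le_trans Plt (leey _)).
  by move: Plt; rewrite xP yP lte_fin /mu sumrB subr_gt0.
set C := relevant_edges (tag t1).
have mu_pos e : 0 < mu e -> load I x e < load J y e.
  by rewrite subr_gt0; exact: real_cost_lt.
have mu_neg e : mu e < 0 -> load J y e < load I x e.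
  by rewrite subr_lt0; exact: real_cost_lt.
have shift t s : strategies I t = strategies J t ->
    simple_path (origin (tag t)) (destination (tag t)) s ->
    flow I x t s < flow J y t s ->
    \sum_(e in s) mu e <= \sum_(e in relevant_edges (tag t) :\: s) mu e.
  move=> IJt ss lt; have ys := le_lt_trans (flow_ge0 t s ox) lt.
  have xs' : 0 < flow I x t (relevant_edges (tag t) :\: s).
    have := flow_demand circ ox ss; have := flow_demand circ oy ss.
    have := flow_ge0 t (relevant_edges (tag t) :\: s) oy; lra.
  have [sJ ys0] := flow_gt0 ys; have [s'I xs0] := flow_gt0 xs'.
  by apply: (ICUE_shift ex ey fx fy IJt) => //; rewrite IJt.
have IJt t : t != t1 -> strategies I t = strategies J t.
  by move=> tt; rewrite /strategies IJ.
have split_sum (s : {set edge g}) (F : edge g -> R) : s \subset C ->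
    \sum_(e in C) F e = \sum_(e in s) F e + \sum_(e in C :\: s) F e.
  by move=> sC; rewrite (big_setID s) /= (finset.setIidPr sC).
have PC := simple_path_sub sP.
have CQ : C :\: (C :\: P) = P.
  by rewrite finset.setDDr finset.setDv finset.set0U; apply/finset.setIidPr.
have new s : strategies I t1 <> strategies J t1 ->
    simple_path (origin (tag t1)) (destination (tag t1)) s ->
    flow I x t1 s < flow J y t1 s -> s = C :\: P.
  move=> nIJ ss lt; have [sE|//] := simple_path_eqVcompl circ sP ss.
  have QI : C :\: P \notin strategies I t1.
    apply/negP => QI; apply: nIJ; apply/finset.setP => r.
    apply/idP/idP => [|/strategies_simple_path rs].
      by rewrite !inE => /andP[-> rI]; exact: fintype.subset_trans rI IJ1.
    by have [->|->] := simple_path_eqVcompl circ sP rs.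
  suff : flow J y t1 P <= flow I x t1 P by rewrite leNgt -sE lt.
  have := flow_demand circ ox sP; have := flow_demand circ oy sP.
  have := flow_ge0 t1 (C :\: P) oy; rewrite -/C.
  have -> : flow I x t1 (C :\: P) = 0 by rewrite /flow (negbTE QI).
  lra.
have [IJ1'|nIJ] := pselect (strategies I t1 = strategies J t1 \/
    \sum_(e in C :\: P) mu e <= \sum_(e in P) mu e).
  have mu0 : forall e, e \in C -> mu e = 0.
    apply: (load_shift_vanish circ ox oy) => [e _|e _|t s tC ss lt].
    - exact: mu_pos.
    - exact: mu_neg.
    have [IJt'|nIJt] := pselect (strategies I t = strategies J t).
      by rewrite -tC; exact: shift.
    have tE : t = t1 by apply/eqP/negPn/negP => /IJt.
    subst t; case: IJ1' => // QP.
    by rewrite (new s) // CQ.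
  move: muP; rewrite big1 ?ltxx // => e eP.
  by apply: mu0; exact: (fintype.subsetP PC).
have QP : \sum_(e in P) mu e < \sum_(e in C :\: P) mu e.
  by rewrite ltNge; apply/negP => QP; apply: nIJ; right.
have nIJ1 : strategies I t1 <> strategies J t1 by move=> ?; apply: nIJ; left.
have [c [uc CE arcs]] := relevant_arcs circ (tag t1).
have sumC F : \sum_(e <- c) F e = \sum_(e in C) F e :> R.
  by rewrite /C CE sum_set_seq.
have t0 : 0 < \sum_(e <- c) mu e by rewrite sumC (split_sum P) //; lra.
have [psi [pos neg tot psiP psi_half]] :=
  arc_level_crossing uc (arcs _ _ erefl sP) t0 muP.
have Cc e : e \in C -> e \in c by rewrite /C CE inE.
suff psi0 : forall e, e \in C -> psi e = 0.
  by move: tot; rewrite sumC big1 // => /eqP; rewrite eq_sym pnatr_eq0.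
apply: (load_shift_vanish circ ox oy) => [e eC p|e eC p|t s tC ss lt].
- by apply: mu_pos; apply: pos => //; exact: Cc.
- by apply: mu_neg; apply: neg => //; exact: Cc.
have sC : s \subset C by rewrite /C -tC simple_path_sub.
move: tot; rewrite sumC (split_sum s) // => tot.
suff : 1 <= \sum_(e in C :\: s) psi e by rewrite -/C; lra.
have [tE|nt] := eqVneq t t1.
  by subst t; rewrite (new s) // CQ.
apply: psi_half; last first.
  have := shift t s (IJt t nt) ss lt; rewrite tC -/C sumC (split_sum s) //; lra.
apply: (arcs _ _ tC); apply: contrapT => nQ.
have := flow_demand circ ox ss; have := flow_demand circ oy ss.
rewrite tC !(flow_eq0 _ _ nQ); lra.
Qed.
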